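(* Let $p\in\mathbb{C}[z_1,z_2]$ be pure stable with $p(0,0)=0$, with local Puiseux factorization data $q_j,L_j,M_j$ ($j=1,\dots,k$) as in the context, and let $K_{min}=\min\{2L_1,\dots,2L_k\}\ge2$ be its universal contact order at $(0,0)$. Write $p=A+iB$ where $A=\tfrac12(p+\bar p)$, $B=\tfrac{1}{2i}(p-\bar p)$ have real coefficients, and assume $p$ has been multiplied by a constant so that its lowest order homogeneous term $P_M$ (of degree $M$) satisfies $P_M=A_M$, where $A_M$ is the degree $M$ homogeneous term of $A$, and the coefficient of $z_2^M$ in $A_M$ is $1$. Then for all but finitely many $t\in\mathbb{R}$, the unit $u(z;t)$ in the local factorization $$A(z)+tB(z)=u(z;t)\prod_{j=1}^{k}\prod_{m=1}^{M_j}\left(z_2+q_j(z_1)+z_1^{2L_j}\psi_{j,m}(z_1;t)\right),\qquad \psi_{j,m}(\cdot\,;t)\in\mathbb{R}\{z_1\},$$ has a homogeneous expansion in $z$ of the form $u(z;t)=1+\sum_{j\ge1}u_j(z;t)$, with $u_j(\cdot\,;t)$ homogeneous of degree $j$, in which the polynomials $u_j(z;t)$ are affine in $t$ for $1\le j\le K_{min}-2$; that is, for these $j$ there are homogeneous polynomials $G_j,H_j$ of degree $j$ in $z$, independent of $t$, with $u_j(z;t)=G_j(z)+tH_j(z)$ for all but finitely many $t\in\mathbb{R}$.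
   Context: $\mathbb{H}$ is the open upper half plane and $\bar p(z)=\overline{p(\bar z_1,\bar z_2)}$. A polynomial $p\in\mathbb{C}[z_1,z_2]$ is pure stable if it has no zeros in $\mathbb{H}^2$ and no nonconstant factor in common with $\bar p$. $\mathbb{C}\{\cdot\}$, $\mathbb{R}\{\cdot\}$ denote convergent power series rings at the origin. It is known that a pure stable $p$ vanishing at $(0,0)$ factors near $(0,0)$ as $$p(z)=v(z)\prod_{j=1}^{k}\prod_{m=1}^{M_j}\left(z_2+q_j(z_1)+z_1^{2L_j}\psi_j(\mu_j^mz_1^{1/M_j})\right),$$ where $v\in\mathbb{C}\{z_1,z_2\}$ is a unit, for each $j$ the inner product over $m$ is an irreducible Weierstrass polynomial in $z_2$ of degree $M_j$, $L_j$ is a positive integer, $\mu_j=e^{2\pi i/M_j}$, $q_j\in\mathbb{R}[z_1]$, $q_j(0)=0$, $q_j'(0)>0$, $\deg q_j<2L_j$, and $\psi_j\in\mathbb{C}\{t\}$ with $\operatorname{Im}\psi_j(0)>0$ (the product over $m$ does not depend on the choice of $M_j$-th root of $z_1$). It is also known that for all but finitely many $t\in\mathbb{R}$ the polynomial $A+tB$ has a factorization near $(0,0)$ of the form displayed in the claim, with the same $q_j,L_j,M_j$ and with $u(\cdot\,;t)\in\mathbb{C}\{z_1,z_2\}$ a uniquely determined unit. *)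

(* Defs.v *)
From HB Require Import structures.
From mathcomp Require Import all_boot all_order all_algebra.
From mathcomp Require Import complex mpoly.
From mathcomp Require Import boolp classical_sets reals.
From mathcomp Require constructive_ereal esum trigo.

(* trigo and esum are not imported: the notation levels of the analysis files
   that they export clash with those of mpoly. *)

Set Implicit Arguments.
Unset Strict Implicit.
Unset Printing Implicit Defensive.

Import Order.TTheory GRing.Theory Num.Theory.

Local Open Scope ring_scope.

(* A record rather than an alias of nat -> K, so that the pointwise product of
   functions can never be inferred in place of the Cauchy product. *)
Record fps (K : comNzRingType) := Fps { fps_coef :> nat -> K }.

HB.instance Definition _ (K : comNzRingType) := gen_eqMixin (fps K).
HB.instance Definition _ (K : comNzRingType) := gen_choiceMixin (fps K).

Section FpsRing.
Variable K : comNzRingType.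
Implicit Types f g h : fps K.

Lemma fpsP f g : (forall n, f n = g n) -> f = g.
Proof. by case: f g => [f] [g] /= e; congr Fps; apply/funext. Qed.

Definition fps_zero : fps K := Fps (fun=> 0).
Definition fps_opp f : fps K := Fps (fun n => - f n).
Definition fps_add f g : fps K := Fps (fun n => f n + g n).

Fact fps_addA : associative fps_add.
Proof. by move=> f g h; apply: fpsP => n /=; rewrite addrA. Qed.
Fact fps_addC : commutative fps_add.
Proof. by move=> f g; apply: fpsP => n /=; rewrite addrC. Qed.
Fact fps_add0 : left_id fps_zero fps_add.
Proof. by move=> f; apply: fpsP => n /=; rewrite add0r. Qed.
Fact fps_addN : left_inverse fps_zero fps_opp fps_add.
Proof. by move=> f; apply: fpsP => n /=; rewrite addNr. Qed.

HB.instance Definition _ :=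
  GRing.isZmodule.Build (fps K) fps_addA fps_addC fps_add0 fps_addN.

Definition fpsC (c : K) : fps K := Fps (fun n => if n == 0%N then c else 0).
Definition fpsX : fps K := Fps (fun n => (n == 1%N)%:R).
Definition fps_mul f g : fps K :=
  Fps (fun n => \sum_(i < n.+1) f i * g (n - i)%N).

Definition fps_trunc N f : {poly K} := \poly_(i < N) f i.

Lemma fps_mul_trunc N f g n : (n < N)%N ->
  fps_mul f g n = (fps_trunc N f * fps_trunc N g)`_n.
Proof.
move=> ltnN; rewrite coefM /=; apply: eq_bigr => i _; rewrite !coef_poly.
by rewrite (leq_ltn_trans (leq_ord i)) // (leq_ltn_trans (leq_subr _ _)).
Qed.

Fact fps_mulA : associative fps_mul.
Proof.
move=> f g h; apply: fpsP => n.
transitivity (fps_trunc n.+1 f * (fps_trunc n.+1 g * fps_trunc n.+1 h))`_n.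
  rewrite [RHS]coefM; apply: eq_bigr => i _; rewrite coef_poly ltn_ord.
  by congr (_ * _); apply: fps_mul_trunc; rewrite ltnS leq_subr.
rewrite mulrA [LHS]coefM; apply: eq_bigr => i _.
rewrite (coef_poly _ _ (n - i)%N) ltnS leq_subr; congr (_ * _).
by symmetry; apply: fps_mul_trunc.
Qed.
Fact fps_mulC : commutative fps_mul.
Proof.
move=> f g; apply: fpsP => n.
by rewrite !(@fps_mul_trunc n.+1) // mulrC.
Qed.
Fact fps_mul1 : left_id (fpsC 1) fps_mul.
Proof.
move=> f; apply: fpsP => n /=; rewrite big_ord_recl /= mul1r subn0.
by rewrite big1 ?addr0 // => i _; rewrite mul0r.
Qed.
Fact fps_mulDl : left_distributive fps_mul fps_add.
Proof.
move=> f g h; apply: fpsP => n /=; rewrite -big_split /=.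
by apply: eq_bigr => i _; rewrite mulrDl.
Qed.
Fact fps_oner_neq0 : fpsC 1 != 0.
Proof.
by apply/eqP => /(congr1 (fun f : fps K => f 0%N)) /= /eqP; rewrite oner_eq0.
Qed.

HB.instance Definition _ := GRing.Zmodule_isComNzRing.Build (fps K)
  fps_mulA fps_mulC fps_mul1 fps_mulDl fps_oner_neq0.

Definition fps_of_poly (p : {poly K}) : fps K := Fps (fun n => p`_n).

(* f(X) |-> f(a X) *)
Definition fps_scale (a : K) f : fps K := Fps (fun n => a ^+ n * f n).

(* f(X) |-> f(X^N), for N > 0 *)
Definition fps_expand (N : nat) f : fps K :=
  Fps (fun n => if (N %| n)%N then f (n %/ N)%N else 0).

End FpsRing.

Arguments fpsX {K}.

Definition fps_map (K K' : comNzRingType) (h : K -> K') (f : fps K) : fps K' :=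
  Fps (fun n => h (f n)).

Section Local.
Variable R : realType.
Local Notation C := R[i].

(* The formal power series ring C[[z1, z2]], as C[[z1]][[z2]]: the coefficient
   of z1^i z2^j in f is f j i; z1 is fpsC fpsX and z2 is fpsX. *)
Definition fps2 := fps (fps C).

(* C{z} and C{z1, z2} are the subrings of the series that converge absolutely
   at r, resp. (r, r), for some r > 0. *)
Definition convergent1 (f : fps C) : Prop :=
  exists2 r : R, 0 < r &
    esum.summable [set: nat] (fun n =>
      constructive_ereal.EFin (Normc.normc (f n) * r ^+ n)).

Definition convergent2 (f : fps2) : Prop :=
  exists2 r : R, 0 < r &
    esum.summable [set: nat * nat] (fun a =>
      constructive_ereal.EFin (Normc.normc (f a.2 a.1) * r ^+ (a.1 + a.2))).

Definition unit2 (f : fps2) : Prop :=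
  convergent2 f /\ exists2 g : fps2, convergent2 g & f * g = 1.

Definition irreducible2 (f : fps2) : Prop :=
  [/\ convergent2 f, ~ unit2 f &
      forall g h : fps2, convergent2 g -> convergent2 h -> f = g * h ->
        unit2 g \/ unit2 h].

Definition z1 : {mpoly C[2]} := 'X_ord0.
Definition z2 : {mpoly C[2]} := 'X_ord_max.

Definition fps2_of_mpoly (p : {mpoly C[2]}) : fps2 :=
  Fps (fun j => Fps (fun i => p@_(U_(ord0) *+ i + U_(ord_max) *+ j)%MM)).

(* The homogeneous component of degree d of f. *)
Definition hcomp (f : fps2) (d : nat) : {mpoly C[2]} :=
  \sum_(j < d.+1) f j (d - j)%N *: (z1 ^+ (d - j) * z2 ^+ j).

(* The polynomial with conjugate coefficients; see pbarE. *)
Definition pbar (p : {mpoly C[2]}) : {mpoly C[2]} := map_mpoly (@conjc R) p.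

Lemma pbarE (p : {mpoly C[2]}) (z : 'I_2 -> C) :
  (pbar p).@[z] = conjc (p.@[fun i => conjc (z i)]).
Proof.
have conj_inj : injective (@conjc R) := can_inj (@conjcK R).
rewrite !mevalE rmorph_sum /= (perm_big _ (msupp_map_mpoly p conj_inj)) /=.
apply: eq_bigr => m _; rewrite mcoeff_map_mpoly rmorphM rmorph_prod /=.
by congr (_ * _); apply: eq_bigr => i _; rewrite rmorphXn /= conjcK.
Qed.

Definition reP (p : {mpoly C[2]}) : {mpoly C[2]} := 2^-1 *: (p + pbar p).
Definition imP (p : {mpoly C[2]}) : {mpoly C[2]} :=
  (2 * 'i%C)^-1 *: (p - pbar p).

Lemma reP_imP (p : {mpoly C[2]}) : p = reP p + 'i%C *: imP p.
Proof.
have i0 : 'i%C != 0 :> C by rewrite eq_complex /= oner_eq0 andbF.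
rewrite /reP /imP scalerA invfM mulrCA mulfV // mulr1 -scalerDr addrACA subrr addr0.
by rewrite -mulr2n -scalerMnr scalerMnl -mulr_natr mulVf ?scale1r ?pnatr_eq0.
Qed.

Definition pure_stable (p : {mpoly C[2]}) : Prop :=
  (forall z : 'I_2 -> C, (forall i, 0 < complex.Im (z i)) -> p.@[z] != 0) /\
  (forall d : {mpoly C[2]},
     (exists e, p = d * e) -> (exists e, pbar p = d * e) ->
     exists c : C, d = c%:MP).

Definition expi2pi (N : nat) : C :=
  Complex (trigo.cos (2 * trigo.pi / N%:R)) (trigo.sin (2 * trigo.pi / N%:R)).

Definition weierstrass (N : nat) (W : {poly fps C}) : Prop :=
  [/\ W \is monic, size W = N.+1,
      forall i, convergent1 W`_i & forall i, (i < N)%N -> W`_i 0%N = 0].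

(* W = \prod_(1 <= m <= N) (z2 + q(z1) + z1^(2L) psi(mu^m z1^(1/N))), as an
   identity in C[[s, z2]] after the substitution z1 = s^N, so that z1^(1/N) is
   read as s. *)
Definition puiseux_product (N L : nat) (q : {poly R}) (psi : fps C)
    (W : {poly fps C}) : Prop :=
  fps_map (fps_expand N) (fps_of_poly W) =
  \prod_(1 <= m < N.+1)
    (fpsX + fpsC (fps_expand N (fps_map (real_complex R) (fps_of_poly q))
                  + fpsX ^+ (2 * L * N) * fps_scale (expi2pi N ^+ m) psi)).

Definition puiseux_factorization (p : {mpoly C[2]}) (k : nat)
    (M L : 'I_k -> nat) (q : 'I_k -> {poly R}) (psi : 'I_k -> fps C) : Prop :=
  exists (v : fps2) (W : 'I_k -> {poly fps C}),
  [/\ unit2 v,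
      fps2_of_mpoly p = v * \prod_(j < k) fps_of_poly (W j) &
      forall j : 'I_k,
      [/\ (0 < M j)%N /\ (0 < L j)%N,
          [/\ (q j).[0] = 0, 0 < (q j)^`().[0] & (size (q j) <= 2 * L j)%N],
          convergent1 (psi j) /\ 0 < complex.Im (psi j 0%N),
          puiseux_product (M j) (L j) (q j) (psi j) (W j) &
          weierstrass (M j) (W j) /\ irreducible2 (fps_of_poly (W j))]].

Definition real_branch_factorization (f : {mpoly C[2]}) (k : nat)
    (M L : 'I_k -> nat) (q : 'I_k -> {poly R})
    (u : fps2) (psi : forall j : 'I_k, 'I_(M j) -> fps R) : Prop :=
  [/\ unit2 u,
      forall j m, convergent1 (fps_map (real_complex R) (psi j m)) &
      fps2_of_mpoly f =
      u * \prod_(j < k) \prod_(m < M j)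
            (fpsX + fpsC (fps_map (real_complex R)
                            (fps_of_poly (q j) + fpsX ^+ (2 * L j) * psi j m)))].

(* The minimum of the 2 L_j; the maximum is only the unit of the iterated minn
   (there is no minimum for k = 0). *)
Definition Kmin (k : nat) (L : 'I_k -> nat) : nat :=
  (\big[minn/(\max_(j < k) (2 * L j))]_(j < k) (2 * L j))%N.

Definition lowest_degree (p : {mpoly C[2]}) (d : nat) : Prop :=
  pihomog mdeg d p != 0 /\ forall e, (e < d)%N -> pihomog mdeg e p = 0.

End Local.

(* Main.v *)
(** Each branch factor z2 + q_j + z1^(2 L_j) psi_{j,m} has order 1 at the origin
and agrees with z2 + q_j up to order 2 L_j, so the whole product agrees with
Q := prod_j (z2 + q_j)^(M_j) in the first Kmin - 1 homogeneous components. Hence,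
in these degrees, the homogeneous components of A + t B are those of u Q. The
lowest component of Q is monic in z2, so that the u_j are determined recursively
by divisions by a polynomial not depending on t; division is linear, and thus
u_j is affine in t. Homogeneous components are read off the blow-up
f(z1, z2) |-> f(s, s z), a ring morphism into C[z][[s]]. *)
Require Import Defs.
From HB Require Import structures.
From mathcomp Require Import all_boot all_order all_algebra.
From mathcomp Require Import complex mpoly.
From mathcomp Require Import boolp classical_sets reals.
From mathcomp Require Import zify.

Set Implicit Arguments.
Unset Strict Implicit.
Unset Printing Implicit Defensive.

Import Order.TTheory GRing.Theory Num.Theory.
Local Open Scope ring_scope.

(** * Coefficients of power series and congruence modulo a power of the variable *)

Section Fps.
Variable K : comNzRingType.
Implicit Types f g h : fps K.

Lemma fps_coefM f g n : (f * g) n = \sum_(i < n.+1) f i * g (n - i)%N.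
Proof. by []. Qed.

Lemma fps_coefD f g n : (f + g) n = f n + g n.
Proof. by []. Qed.

Lemma fps_coef_sum I (r : seq I) (P : pred I) (F : I -> fps K) n :
  (\sum_(i <- r | P i) F i) n = \sum_(i <- r | P i) F i n.
Proof. exact: (big_morph (fun f : fps K => f n) (fun f g => erefl) erefl). Qed.

Lemma fps_coefXM f n : (fpsX * f) n = if n is n'.+1 then f n' else 0.
Proof.
rewrite fps_coefM big_ord_recl /= mul0r add0r; case: n => [|n].
  by rewrite big_ord0.
rewrite big_ord_recl /= mul1r subSS subn0 big1 ?addr0 // => i _.
by rewrite mul0r.
Qed.

Lemma fps_coefXnM f m n :
  (fpsX ^+ m * f) n = if (n < m)%N then 0 else f (n - m)%N.
Proof.
elim: m n => [|m IHm] n; first by rewrite mul1r subn0.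
rewrite exprS -mulrA fps_coefXM; by case: n.
Qed.

Definition fps_eqmod N f g := forall n, (n < N)%N -> f n = g n.

Lemma fps_eqmodM N f1 f2 g1 g2 : fps_eqmod N f1 f2 -> fps_eqmod N g1 g2 ->
  fps_eqmod N (f1 * g1) (f2 * g2).
Proof.
move=> ef eg n ltnN; rewrite !fps_coefM; apply: eq_bigr => i _.
rewrite ef ?eg // ?(leq_ltn_trans (leq_subr _ _)) //.
by rewrite (leq_ltn_trans (leq_ord i)).
Qed.

Lemma fps_eqmod_prod N I (r : seq I) (P : pred I) (F G : I -> fps K) :
  (forall i, P i -> fps_eqmod N (F i) (G i)) ->
  fps_eqmod N (\prod_(i <- r | P i) F i) (\prod_(i <- r | P i) G i).
Proof. by move=> eFG; elim/big_rec2: _ => // i f g Pi; apply/fps_eqmodM/eFG. Qed.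

Lemma fps_coef0_prod I (r : seq I) (P : pred I) (F : I -> fps K) :
  (\prod_(i <- r | P i) F i) 0%N = \prod_(i <- r | P i) F i 0%N.
Proof.
by apply: (big_morph (fun f : fps K => f 0%N)) => // f g; rewrite fps_coefM big_ord1.
Qed.

Lemma fps_coef_map (K' : comNzRingType) (h : K -> K') f n :
  fps_map h f n = h (f n).
Proof. by []. Qed.

End Fps.

(* f(s, s z), as a power series in s: its coefficient of s^d is the
   dehomogenization at z1 = 1 of the homogeneous component of degree d. *)
Definition fps_blowup (K : comNzRingType) (f : fps (fps K)) : fps {poly K} :=
  Fps (fun d => \poly_(j < d.+1) f j (d - j)%N).

(** * The blow-up as a multiplicative map *)

Section Blowup.
Variable K : comNzRingType.
Implicit Types f g : fps (fps K).

Lemma fps_blowup1 : fps_blowup (1 : fps (fps K)) = 1.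
Proof.
apply: fpsP => d; apply/polyP => j; rewrite coef_poly.
case: d j => [|d] [|j] //=; rewrite ?coefC ?coef0 //.
by case: ifP.
Qed.

Lemma fps_blowupM : {morph @fps_blowup K : f g / f * g}.
Proof.
move=> f g; apply: fpsP => d; apply/polyP => j.
rewrite fps_coefM coef_sum coef_poly ltnS; case: (leqP j d) => [lejd|ltdj]; last first.
  (* A nonzero term would give [j = a + (j - a) <= e + (d - e) = d]. *)
  rewrite big1 // => e _; rewrite coefM big1 // => a _; rewrite !coef_poly.
  case: ifP => [lae|_]; last by rewrite mul0r.
  case: ifP => [lja|_]; last by rewrite mulr0.
  have := leq_add lae lja; have := ltn_ord e; have := ltn_ord a; lia.
rewrite fps_coefM fps_coef_sum.
transitivity (\sum_(a < j.+1) \sum_(e < d.+1)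
    (fps_blowup f e)`_a * (fps_blowup g (d - e)%N)`_(j - a)); last first.
  by rewrite exchange_big; apply: eq_bigr => e _; rewrite coefM.
apply: eq_bigr => a _; rewrite fps_coefM.
have leaj := leq_ord a.
rewrite -(big_mkord xpredT (fun b => f a b * g (j - a)%N (d - j - b)%N)).
rewrite -(big_mkord xpredT
  (fun e => (fps_blowup f e)`_a * (fps_blowup g (d - e)%N)`_(j - a))).
(* Only [a <= e <= d - j + a] contributes: below, [a] exceeds the degree bound of the first factor;
   above, [j - a] exceeds that of the second. The shift [e = a + b] then gives the Cauchy product in
   [z1]. *)
rewrite [RHS](@big_cat_nat _ _ _ a) /=; [|lia|lia].
rewrite [in RHS](@big_cat_nat _ _ _ (d - j + a).+1 a) /=; [|lia|lia].
rewrite [in RHS]big1_seq ?add0r; last first.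
  move=> e; rewrite mem_index_iota => /= ?; rewrite coef_poly ifF ?mul0r //; lia.
rewrite [X in _ = _ + X]big1_seq ?addr0; last first.
  move=> e; rewrite mem_index_iota => /= ?.
  rewrite [X in _ * X]coef_poly ifF ?mulr0 //; lia.
symmetry; rewrite -{1}[nat_of_ord a]add0n big_addn subSn; last by lia.
rewrite addnK; apply: eq_big_nat => b /= ltb.
rewrite !coef_poly !ifT; [|lia|lia].
by congr (f _ _ * g _ _); lia.
Qed.

Lemma fps_blowup_prod I (r : seq I) (P : pred I) (F : I -> fps (fps K)) :
  fps_blowup (\prod_(i <- r | P i) F i) = \prod_(i <- r | P i) fps_blowup (F i).
Proof. exact: (big_morph _ fps_blowupM fps_blowup1). Qed.

(* (s z + c(s)) / s, when c(0) = 0 *)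
Definition blowup_factor (c : fps K) : fps {poly K} :=
  Fps (fun d => (if d == 0%N then 'X else 0) + (c d.+1)%:P).

Lemma blowup_factorE (c : fps K) d :
  blowup_factor c d = (if d == 0%N then 'X else 0) + (c d.+1)%:P.
Proof. by []. Qed.

Lemma fps_blowup_factor (c : fps K) : c 0%N = 0 ->
  fps_blowup (fpsX + fpsC c) = fpsX * blowup_factor c.
Proof.
move=> c0; apply: fpsP => d; rewrite fps_coefXM; apply/polyP => j.
rewrite coef_poly; case: d j => [|d] [|j] //=.
- by rewrite add0r c0 coef0.
- by rewrite coef0.
- by rewrite add0r coefD coefC eqxx; case: eqP => _; rewrite ?coefX ?coef0 add0r.
rewrite coefD coefC addr0 /= addr0 ltnS subSS.
case: d j => [|d] [|j] //=; rewrite ?coefX ?coef0 //.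
by case: ifP; rewrite ?addr0.
Qed.

End Blowup.

(** * Recursive division by a series independent of t *)

(** Coefficient [n] of [u * Q] is [u n * Q 0] plus terms in the earlier [u i], which are affine in
    [t] by induction. Euclidean division by [Q 0] is linear, even where the separate divisions for
    [a] and [b] leave remainders, so [u n] is affine too. *)
Lemma affine_quotients (F : fieldType) (Q : fps {poly F}) (a b : nat -> {poly F})
    (n : nat) : Q 0%N != 0 ->
  exists G H : nat -> {poly F}, forall (t : F) (u : fps {poly F}),
    (forall j, (j < n)%N -> (u * Q) j = a j + t *: b j) ->
    forall j, (j < n)%N -> u j = G j + t *: H j.
Proof.
move=> Q0; elim: n => [|n [G [H GH]]]; first by exists (fun=> 0), (fun=> 0).
pose quo (c d : nat -> {poly F}) :=
  (c n - \sum_(i < n) d i * Q (n - i)%N) %/ Q 0%N.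
exists (fun j => if (j < n)%N then G j else quo a G).
exists (fun j => if (j < n)%N then H j else quo b H) => t u uQ.
have u_lt j : (j < n)%N -> u j = G j + t *: H j.
  by apply: GH => i /ltnW; rewrite -ltnS; apply: uQ.
move=> j; rewrite ltnS leq_eqVlt => /orP[/eqP->|ltjn]; last by rewrite ltjn u_lt.
rewrite ltnn -[u n](mulpK _ Q0) -divpZl -divpD; congr (_ %/ _).
have := uQ n (ltnSn n); rewrite fps_coefM big_ord_recr /= subnn => /eqP.
rewrite addrC eq_sym -subr_eq => /eqP <-.
rewrite scalerBr addrACA -opprD; congr (_ - _).
rewrite scaler_sumr -big_split; apply: eq_bigr => i _ /=.
by rewrite u_lt // mulrDl scalerAl.
Qed.

Lemma bigminn_le (I : eqType) (r : seq I) (x : nat) (F : I -> nat) (i : I) :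
  i \in r -> (\big[minn/x]_(j <- r) F j <= F i)%N.
Proof.
elim: r => // j r IHr; rewrite inE big_cons => /orP[/eqP->|/IHr]; first 
  exact: geq_minl.
by apply: leq_trans; apply: geq_minr.
Qed.

Lemma mcoeff_pihomog n (K : nzRingType) d (p : {mpoly K[n]}) (m : 'X_{1..n}) :
  (pihomog mdeg d p)@_m = if mdeg m == d then p@_m else 0.
Proof.
rewrite pihomogE raddf_sum /=.
under eq_bigr do rewrite mcoeffZ mcoeffX.
have [pm|pm] := boolP (m \in msupp p); last first.
  rewrite (memN_msupp_eq0 pm) if_same big1_seq // => m' /andP[_ m'p].
  by case: eqP m'p => [->|_ _]; rewrite ?mulr0 // (negPf pm).
rewrite big_mkcond (bigD1_seq m) //= eqxx mulr1 big1 ?addr0 // => m' ne.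
by rewrite (negPf ne) mulr0 if_same.
Qed.

(** * Homogeneous components of polynomials and blow-up of the branch product *)

Section Complex.
Variable R : realType.
Local Notation C := R[i].
Implicit Types p f : {mpoly C[2]}.

(** The form [z1^d P(z2/z1)], with the coefficients of [P] beyond degree [d] discarded, so that it
    is a form of degree [d], linear in [P], without any degree bound on [P]. *)
Definition homogenize (d : nat) (P : {poly C}) : {mpoly C[2]} :=
  \sum_(j < d.+1) P`_j *: (z1 R ^+ (d - j) * z2 R ^+ j).

Lemma homogenize_homog d P : homogenize d P \is d.-homog for mdeg.
Proof.
apply: rpred_sum => j _; apply: dhomogZ.
rewrite -[X in X.-homog for _](@subnK j d) ?leq_ord //.
have X_homog (i : 'I_2) e : ('X_i : {mpoly C[2]}) ^+ e \is e.-homog for mdeg.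
  by rewrite -[X in X.-homog for _]mul1n; apply: dhomogMn; rewrite dhomogX /= mdeg1.
by apply: dhomogM; apply: X_homog.
Qed.

Lemma homogenizeDZ d P Q (c : C) :
  homogenize d (P + c *: Q) = homogenize d P + c *: homogenize d Q.
Proof.
rewrite scaler_sumr -big_split; apply: eq_bigr => j _.
by rewrite coefD coefZ scalerDl scalerA.
Qed.

Lemma hcomp_blowup (f : fps2 R) d : hcomp f d = homogenize d (fps_blowup f d).
Proof. by apply: eq_bigr => j _; rewrite coef_poly ltn_ord. Qed.

Lemma blowup_mpoly_coef f d j : (fps_blowup (fps2_of_mpoly f) d)`_j =
  if (j < d.+1)%N then f@_(U_(ord0) *+ (d - j) + U_(ord_max) *+ j)%MM else 0.
Proof. by rewrite coef_poly. Qed.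

Lemma blowup_mpolyDZ f g (c : C) d :
  fps_blowup (fps2_of_mpoly (f + c *: g)) d =
  fps_blowup (fps2_of_mpoly f) d + c *: fps_blowup (fps2_of_mpoly g) d.
Proof.
apply/polyP => j; rewrite coefD coefZ !blowup_mpoly_coef mcoeffD mcoeffZ.
by case: ifP; rewrite ?mulr0 ?addr0.
Qed.

Lemma blowup_mpoly_pihomog f d : fps_blowup (fps2_of_mpoly f) d =
  fps_blowup (fps2_of_mpoly (pihomog mdeg d f)) d.
Proof.
apply/polyP => j; rewrite !blowup_mpoly_coef; case: ltnP => // ltjd.
by rewrite mcoeff_pihomog mdegD !mdegMn !mdeg1 !mul1n subnK // eqxx.
Qed.

Lemma pbar_pihomog p d : pihomog mdeg d p = 0 -> pihomog mdeg d (pbar p) = 0.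
Proof.
move=> p0; apply/mpolyP => m; rewrite mcoeff_pihomog mcoeff0.
have /(congr1 (mcoeff m)) := p0; rewrite mcoeff_pihomog mcoeff0.
by case: ifP => // _ pm0; rewrite /pbar mcoeff_map_mpoly /= pm0 rmorph0.
Qed.

Lemma reP_pihomog0 p d : pihomog mdeg d p = 0 -> pihomog mdeg d (reP p) = 0.
Proof.
by move=> p0; rewrite /reP linearZ linearD /= (pbar_pihomog p0) p0 addr0 scaler0.
Qed.

Lemma imP_pihomog0 p d : pihomog mdeg d p = 0 -> pihomog mdeg d (imP p) = 0.
Proof.
by move=> p0; rewrite /imP linearZ linearB /= (pbar_pihomog p0) p0 subrr scaler0.
Qed.

Lemma imP_pihomog_eq0 p d : pihomog mdeg d p = pihomog mdeg d (reP p) ->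
  pihomog mdeg d (imP p) = 0.
Proof.
move=> /eqP; rewrite {1}(reP_imP p) linearD /= [X in _ + X]linearZ /= addrC.
rewrite -subr_eq0 addrK.
rewrite scaler_eq0 => /orP[|/eqP//].
by rewrite eq_complex /= oner_eq0 andbF.
Qed.

(** Every branch passes through the origin, so each factor yields one power of s, [\sum_j M j] in
    all. In the cofactor [V], the [psi j m] enter only from degree [2 * L j - 1] on. *)
Lemma branch_blowup k (M L : 'I_k -> nat) (q : 'I_k -> {poly R})
    (psi : forall j : 'I_k, 'I_(M j) -> fps R) (u F : fps2 R) :
  (forall j, 0 < L j)%N -> (forall j, (q j).[0] = 0) ->
  F = u * \prod_(j < k) \prod_(m < M j)
        (fpsX + fpsC (fps_map (real_complex R)
                        (fps_of_poly (q j) + fpsX ^+ (2 * L j) * psi j m))) ->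
  exists V, fps_blowup F = fpsX ^+ (\sum_(j < k) M j) * V /\
    forall N, (forall j, N < 2 * L j)%N -> fps_eqmod N V
      (fps_blowup u *
       \prod_(j < k) blowup_factor (fps_map (real_complex R) (fps_of_poly (q j))) ^+ M j).
Proof.
move=> L_gt0 q0 ->; rewrite fps_blowupM fps_blowup_prod.
under eq_bigr => j _.
  rewrite fps_blowup_prod.
  under eq_bigr => m _.
    rewrite fps_blowup_factor; last first.
      rewrite fps_coef_map fps_coefD fps_coefXnM [fps_of_poly _ _]/= -horner_coef0 q0.
      by rewrite muln_gt0 /= L_gt0 addr0 rmorph0.
    over.
  rewrite big_split /= prodr_const card_ord.
  over.
rewrite big_split /= prodrXr mulrCA; eexists; split; first by [].
move=> N ltN; apply: fps_eqmodM => //; apply: fps_eqmod_prod => j _.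
have exprE (x : fps {poly C}) : x ^+ M j = \prod_(m < M j) x.
  by rewrite prodr_const card_ord.
rewrite exprE; apply: fps_eqmod_prod => m _ d ltdN.
(* Division by s shifts the index: coefficient [d] involves coefficient [d.+1] of the branch, and
   [d.+1 <= N < 2 * L j]. *)
rewrite !blowup_factorE !fps_coef_map fps_coefD fps_coefXnM.
by rewrite (leq_ltn_trans ltdN (ltN j)) addr0.
Qed.

Lemma blowup_prod_monic k (M : 'I_k -> nat) (c : 'I_k -> fps C) :
  (\prod_(j < k) blowup_factor (c j) ^+ M j) 0%N \is monic.
Proof.
rewrite fps_coef0_prod; apply: monic_prod => j _.
rewrite -[X in _ ^+ X]card_ord -prodr_const fps_coef0_prod.
by apply: monic_prod => m _ /=; apply: monicXaddC.
Qed.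

(** Setting z1 = 1 in a form of degree d turns the coefficient of z2^d into that of the highest
    possible degree. *)
Lemma lowest_term_lead f d : f@_(U_(ord_max) *+ d)%MM = 1 ->
  lead_coef (fps_blowup (fps2_of_mpoly f) d) = 1.
Proof.
move=> f1; set P := fps_blowup _ _.
have P1 : P`_d = 1 by rewrite blowup_mpoly_coef ltnSn subnn mulm0n add0m f1.
suff sP : size P = d.+1 by rewrite lead_coefE sP.
apply/eqP; rewrite eqn_leq size_poly ltnNge.
by apply/negP => /leq_sizeP/(_ d (leqnn d))/eqP; rewrite P1 oner_eq0.
Qed.

End Complex.

(** * Comparison of A + tB with the product of the branches *)

Theorem theorem2p25 (R : realType) (p : {mpoly R[i][2]})
    (k : nat) (M L : 'I_k -> nat) (q : 'I_k -> {poly R})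
    (psi : 'I_k -> fps R[i]) (d0 : nat) :
  pure_stable p ->
  p.@[fun=> 0] = 0 ->
  puiseux_factorization p M L q psi ->
  lowest_degree p d0 ->
  pihomog mdeg d0 p = pihomog mdeg d0 (reP p) ->
  (pihomog mdeg d0 (reP p))@_(U_(ord_max) *+ d0)%MM = 1 ->
  exists (E : seq R) (G H : nat -> {mpoly R[i][2]}),
    (forall j, (0 < j)%N -> (j + 2 <= Kmin L)%N ->
       G j \is j.-homog for mdeg /\ H j \is j.-homog for mdeg) /\
    forall t : R, t \notin E ->
    forall (u : fps2 R) (psit : forall j : 'I_k, 'I_(M j) -> fps R),
      real_branch_factorization (reP p + t%:C%C *: imP p) L q u psit ->
      hcomp u 0 = 1 /\
      forall j, (0 < j)%N -> (j + 2 <= Kmin L)%N ->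
        hcomp u j = G j + t%:C%C *: H j.
Proof.
move=> _ _ [v [W [_ _ data]]] [_ p_lt] p_eq A1.
have L_gt0 j : (0 < L j)%N by case: (data j) => [[]].
have q0 j : (q j).[0] = 0 by case: (data j) => [_ []].
pose A d := fps_blowup (fps2_of_mpoly (reP p)) d.
pose B d := fps_blowup (fps2_of_mpoly (imP p)) d.
pose c j := fps_map (real_complex R) (fps_of_poly (q j)).
pose Q := \prod_(j < k) blowup_factor (c j) ^+ M j.
have Q_monic : Q 0%N \is monic by apply: blowup_prod_monic.
have blowup0 d : fps_blowup (fps2_of_mpoly (0 : {mpoly R[i][2]})) d = 0.
  by apply/polyP => j; rewrite blowup_mpoly_coef mcoeff0 if_same coef0.
have A_lt d : (d < d0)%N -> A d = 0.
  by move=> /p_lt/reP_pihomog0 pd; rewrite /A blowup_mpoly_pihomog pd blowup0.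
have B_lt d : (d < d0)%N -> B d = 0.
  by move=> /p_lt/imP_pihomog0 pd; rewrite /B blowup_mpoly_pihomog pd blowup0.
(* Hence the lowest component of A + tB is that of A, for every t. *)
have B_d0 : B d0 = 0.
  by rewrite /B blowup_mpoly_pihomog (imP_pihomog_eq0 p_eq) blowup0.
have A_d0 : lead_coef (A d0) = 1.
  by rewrite /A blowup_mpoly_pihomog lowest_term_lead.
(* The shift by [d0] removes the common power of s; the indices below [(Kmin L).-1] are those up to
   Kmin - 2. *)
have [G [H GH]] := affine_quotients (fun j => A (j + d0)%N) (fun j => B (j + d0)%N)
  (Kmin L).-1 (monic_neq0 Q_monic).
(* No t is excluded: the conclusion concerns given factorizations, and a t without one satisfies it
   vacuously. *)
exists [::], (fun j => homogenize j (G j)), (fun j => homogenize j (H j)).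
split=> [j _ _|t _ u psit [[_ [g _ ug]] _ fact]].
  by split; apply: homogenize_homog.
have [V [FV V_mod]] := branch_blowup L_gt0 q0 fact.
have FE d : A d + t%:C%C *: B d = (fpsX ^+ (\sum_(j < k) M j) * V) d.
  by rewrite -FV blowup_mpolyDZ.
have u0 : fps_blowup u 0%N = (u 0%N 0%N)%:P.
  by apply/polyP => -[|j]; rewrite coef_poly coefC.
have V0 : V 0%N = fps_blowup u 0%N * Q 0%N.
  rewrite (V_mod 1%N) ?fps_coefM ?big_ord1 // => j.
  by rewrite mul2n -addnn; move: (L_gt0 j); lia.
(* The unit [u] has nonzero constant term, since [u * g = 1]. *)
have V0_neq0 : V 0%N != 0.
  rewrite V0 mulf_neq0 ?(monic_neq0 Q_monic) //.
  apply/eqP => u00; have /(congr1 (fun f => fps_blowup f 0%N)) := ug.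
  rewrite fps_blowupM fps_blowup1 fps_coefM big_ord1 u00 mul0r => /eqP.
  by rewrite eq_sym oner_eq0.
(* Both numbers are the order in s of the blow-up of A + tB, as [A d0] and [V 0] are nonzero. *)
have d0E : \sum_(j < k) M j = d0.
  apply/eqP; rewrite eqn_leq; apply/andP; split; rewrite leqNgt; apply/negP => lt.
    have := FE d0; rewrite fps_coefXnM lt B_d0 scaler0 addr0 => A0.
    by move/eqP: A_d0; rewrite A0 lead_coef0 eq_sym oner_eq0.
  have := FE (\sum_(j < k) M j)%N; rewrite fps_coefXnM ltnn subnn.
  by rewrite A_lt // B_lt // scaler0 addr0 => /esym/eqP; rewrite (negPf V0_neq0).
have VE j : V j = A (j + d0)%N + t%:C%C *: B (j + d0)%N.
  by rewrite FE d0E fps_coefXnM ltnNge leq_addl addnK.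
split.
  rewrite hcomp_blowup /homogenize big_ord1 u0 coefC /= !expr0 mulr1.
  (* Leading coefficients are compared in [A d0 = u(0,0) * Q 0], where [Q 0] is monic. *)
  suff -> : u 0%N 0%N = 1 by rewrite scale1r.
  move: A_d0; have := VE 0%N; rewrite V0 add0n B_d0 scaler0 addr0 u0 => <-.
  by rewrite mul_polyC lead_coefZ (monicP Q_monic) mulr1.
move=> j j_gt0 ltj; rewrite hcomp_blowup -homogenizeDZ; congr (homogenize _ _).
apply: GH => [i lti|]; last by lia.
(* Here N is [(Kmin L).-1], which is less than [2 * L m] because [Kmin L] is positive and at most
   [2 * L m]. *)
rewrite -VE; symmetry; apply: V_mod lti => m.
have := bigminn_le (\max_(j < k) (2 * L j)) (fun j => 2 * L j)%N (mem_index_enum m).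
by rewrite -/(Kmin L); move: ltj j_gt0; lia.
Qed.
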